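(* For all integers $t\ge 2$ and $b\ge1$ and every real $\delta>0$ there exists $a_0$ such that for all positive integers $a_1,\dots,a_b$ with $a_i>a_0$ for every $i\in[b]$, \[ \sum_{i=1}^b\sqrt{t(t-1)a_i}\ \le\ \tau_t(K_{a_1,\dots,a_b})\ \le\ (1+\delta)\sum_{i=1}^b\sqrt{t(t-1)a_i}. \]
   Context: $K_{a_1,\dots,a_b}$ is the complete $b$-partite graph with parts of sizes $a_1,\dots,a_b$. For an integer $t\ge1$, a $t$-tone coloring of a graph $G$ assigns to each vertex $v$ a set $f(v)$ of exactly $t$ colors from a color set $C$ such that $|f(u)\cap f(v)|<d(u,v)$ for all distinct vertices $u,v$, where $d(u,v)$ is the graph distance. The $t$-tone chromatic number $\tau_t(G)$ is the minimum $|C|$ over all $t$-tone colorings of $G$.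
   Formalization: The formal theorem assumes b ≥ 2 instead of b ≥ 1: for b = 1 the graph has no edges, all distances are infinite, and τ_t equals t, so the lower bound fails for large a_1. *)

(* Defs.v *)
From mathcomp Require Import all_boot.

Set Implicit Arguments.
Unset Strict Implicit.
Unset Printing Implicit Defensive.

Record sgraph := SGraph {
  vertex :> finType;
  edge : rel vertex;
  edge_sym : symmetric edge;
  edge_irr : irreflexive edge }.

Definition has_walk (G : sgraph) (n : nat) (u v : G) : bool :=
  [exists p : n.-tuple G, path (@edge G) u p && (last u p == v)].

Lemma connect_has_walk (G : sgraph) (u v : G) :
  connect (@edge G) u v -> exists n, has_walk n u v.
Proof.
case/connectP=> p pth ->; exists (size p).
by apply/existsP; exists (in_tuple p); rewrite /= pth eqxx.
Qed.

(* [None] is the infinite distance between distinct components. *)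
Definition gdist (G : sgraph) (u v : G) : option nat :=
  if @idP (connect (@edge G) u v) is ReflectT uv
  then Some (ex_minn (connect_has_walk uv)) else None.

Definition lt_dist (n : nat) (d : option nat) : bool :=
  if d is Some m then n < m else true.

Definition tone_coloring (t : nat) (G : sgraph) (C : finType)
    (f : {ffun G -> {set C}}) : bool :=
  [forall v, #|f v| == t] &&
  [forall u, forall v, (u != v) ==> lt_dist #|f u :&: f v| (gdist u v)].

Definition tone_colorable (t : nat) (G : sgraph) (n : nat) : bool :=
  [exists f : {ffun G -> {set 'I_n}}, tone_coloring t f].

Lemma lt_dist0 (G : sgraph) (u v : G) : u != v -> lt_dist 0 (gdist u v).
Proof.
move=> neq_uv; rewrite /gdist; case: {-}_ / idP => // uv.
case: ex_minnP => -[|//] /existsP[p]; rewrite tuple0 /=.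
by rewrite (negPf neq_uv).
Qed.

Lemma tone_colorable_ex (t : nat) (G : sgraph) :
  exists n, tone_colorable t G n.
Proof.
exists #|{: G * 'I_t}|; apply/existsP.
have inj1 (v : G) : injective (fun j : 'I_t => enum_rank (v, j)).
  by move=> i j /enum_rank_inj [].
exists [ffun v => [set enum_rank (v, j) | j : 'I_t]]; apply/andP; split.
  by apply/forallP=> v; rewrite ffunE card_imset // card_ord.
apply/forallP=> u; apply/forallP=> v; apply/implyP=> neq_uv; rewrite !ffunE.
suff -> : [set enum_rank (u, j) | j : 'I_t]
          :&: [set enum_rank (v, j) | j : 'I_t] = set0.
  by rewrite cards0 lt_dist0.
apply/setP=> c; rewrite !inE; apply/negP=> /andP[/imsetP[i _ ->]].
by case/imsetP=> j _ /enum_rank_inj [uv _]; rewrite uv eqxx in neq_uv.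
Qed.

Definition tone_chromatic_number (t : nat) (G : sgraph) : nat :=
  ex_minn (tone_colorable_ex t G).

Definition cmp_edge (b : nat) (a : 'I_b -> nat) : rel {i : 'I_b & 'I_(a i)} :=
  fun u v => tag u != tag v.

Lemma cmp_edge_sym (b : nat) (a : 'I_b -> nat) : symmetric (@cmp_edge b a).
Proof. by move=> u v; rewrite /cmp_edge eq_sym. Qed.

Lemma cmp_edge_irr (b : nat) (a : 'I_b -> nat) : irreflexive (@cmp_edge b a).
Proof. by move=> u; rewrite /cmp_edge eqxx. Qed.

Definition complete_multipartite (b : nat) (a : 'I_b -> nat) : sgraph :=
  SGraph (@cmp_edge_sym b a) (@cmp_edge_irr b a).

(* A graph with a single part has no edges, so its distances are infinite and
   t colors suffice whatever the number of vertices.  The lower bound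
   sqrt (t (t - 1) a_1) therefore fails for one large part when t >= 2, which is
   why the theorem is stated for at least two parts. *)
Lemma tone_chromatic_number_one_part (t : nat) (a : 'I_1 -> nat) :
  0 < a ord0 -> tone_chromatic_number t (complete_multipartite a) = t.
Proof.
move=> a_gt0; rewrite /tone_chromatic_number; case: ex_minnP => n col min_n.
apply/eqP; rewrite eqn_leq; apply/andP; split.
  apply: min_n; apply/existsP; exists [ffun=> setT]; apply/andP; split.
    by apply/forallP=> v; rewrite ffunE cardsT card_ord.
  apply/forallP=> u; apply/forallP=> v; apply/implyP=> neq_uv.
  rewrite /gdist; case: {-}_ / idP => // uv; exfalso; case/connectP: uv.
  case=> [_ vu|w p /=]; first by rewrite vu eqxx in neq_uv.
  by rewrite /cmp_edge !ord1 eqxx.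
case/existsP: col => f /andP[/forallP card_f _].
rewrite -(eqP (card_f (Tagged (fun i => 'I_(a i)) (Ordinal a_gt0)))).
by rewrite -[X in _ <= X]card_ord max_card.
Qed.

(* Main.v *)
(** Vertices in different parts are at distance 1 and vertices in the same part
    at distance 2, so a t-tone coloring is a choice of disjoint color sets, one
    per part, together with a family of [a i] t-sets pairwise meeting in at
    most one color inside the i-th color set. Counting ordered pairs of colors
    gives the lower bound.

    For the upper bound one needs families that cover almost all pairs. If [m]
    is coprime to all positive integers below [t], the [m ^ 2] lines
    [{(i, x + i y mod m) : i < t}] cover every pair of points of
    [{0..t-1} x Z/m] with distinct first coordinates exactly once; filling each
    fibre with a family on [m] points and iterating makes the uncovered
    fraction of pairs tend to 0. Taking [m] congruent to 1 modulo [t!] avoids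
    any need for primes. *)
Require Import Defs.
From HB Require Import structures.
From mathcomp Require Import all_boot all_order all_algebra.
From mathcomp Require Import reals zify ring lra.
Import Order.TTheory GRing.Theory Num.Theory.

Set Implicit Arguments.
Unset Strict Implicit.
Unset Printing Implicit Defensive.

(** * Families of [t]-sets pairwise meeting in at most one point *)

Definition packing (t : nat) (B V : finType) (F : B -> {set V}) : Prop :=
  (forall i, #|F i| = t) /\ (forall i j, i != j -> #|F i :&: F j| <= 1).

Definition packable (t a n : nat) : Prop :=
  exists F : 'I_a -> {set 'I_n}, packing t F.

Lemma inj_of_leq_card (S T : finType) :
  #|S| <= #|T| -> exists h : S -> T, injective h.
Proof.
move=> leST; exists (fun x => enum_val (widen_ord leST (enum_rank x))).
move=> x y /enum_val_inj /(congr1 val) /= /val_inj; exact: enum_rank_inj.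
Qed.

(** Only cardinalities matter, so constructions may use whatever finite types of indices and points
    are convenient. *)
Lemma packable_of_packing (t a n : nat) (B V : finType) (F : B -> {set V}) :
  packing t F -> a <= #|B| -> #|V| <= n -> packable t a n.
Proof.
move=> [cardF capF] leaB leVn.
have [|h injh] := @inj_of_leq_card 'I_a B; first by rewrite card_ord.
have [|g injg] := @inj_of_leq_card V 'I_n; first by rewrite card_ord.
exists (fun i => g @: F (h i)); split=> [i|i j neq_ij].
  by rewrite card_imset.
rewrite -imsetI; last by move=> x y _ _; apply: injg.
by rewrite card_imset // capF // (inj_eq injh).
Qed.

Lemma modn_mul_inj (d m y z : nat) :
  coprime d m -> d * y = d * z %[mod m] -> y = z %[mod m].
Proof.
move=> co_dm; wlog le_yz : y z / y <= z => [hw|].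
  by case/orP: (leq_total y z) => le E; [|apply/esym]; apply: hw => //.
move/eqP; rewrite eq_sym eqn_mod_dvd ?leq_mul2l ?le_yz ?orbT // -mulnBr.
rewrite Gauss_dvdr 1?coprime_sym // -eqn_mod_dvd // => /eqP.
exact: esym.
Qed.

(** * Lines over the integers modulo [m], with filled fibres *)

Section TransversalDesign.

Variables (t m : nat) (m_gt0 : 0 < m).
Hypothesis co_m : forall d, 0 < d < t -> coprime d m.

Definition td_line (x y : 'I_m) (i : 'I_t) : 'I_m :=
  Ordinal (ltn_pmod (x + i * y) m_gt0).

(** Subtracting the values at [i] and [j] leaves [(j - i) * y] modulo [m], and [0 < j - i < t] makes
    [j - i] invertible; so two points in different fibres determine the line. *)
Lemma td_line_inj (x y x' y' : 'I_m) (i j : 'I_t) : i < j ->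
  td_line x y i = td_line x' y' i -> td_line x y j = td_line x' y' j ->
  x = x' /\ y = y'.
Proof.
move=> lt_ij /(congr1 val) /= Ei /(congr1 val) /= Ej.
have Ey : y = y' %[mod m].
  apply: (@modn_mul_inj (j - i)).
    by apply: co_m; rewrite subn_gt0 lt_ij (leq_ltn_trans (leq_subr _ _)).
  apply/eqP; rewrite -(eqn_modDl (x + i * y)) -addnA -mulnDl subnKC 1?ltnW //.
  apply/eqP; rewrite Ej -[RHS]modnDml Ei modnDml -addnA -mulnDl subnKC //.
  exact: ltnW.
have eq_y : y = y' by apply: val_inj; rewrite !modn_small in Ey.
split=> //; apply: val_inj; rewrite -eq_y in Ei.
by move/eqP: Ei; rewrite eqn_modDr !modn_small // => /eqP.
Qed.

Variables (B : finType) (F : B -> {set 'I_m}).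
Hypothesis packF : packing t F.

(** Left indices are the lines, as graphs over ['I_t]; right indices are the copies of [F] inside
    each fibre. *)
Definition td_block (c : 'I_m * 'I_m + 'I_t * B) : {set 'I_t * 'I_m} :=
  match c with
  | inl (x, y) => [set p | p.2 == td_line x y p.1]
  | inr (i, e) => [set p | (p.1 == i) && (p.2 \in F e)]
  end.

Lemma card_td_block c : #|td_block c| = t.
Proof.
have [cardF _] := packF; case: c => [[x y]|[i e]] /=.
  have -> : [set p : 'I_t * 'I_m | p.2 == td_line x y p.1] =
            [set (i, td_line x y i) | i : 'I_t].
    apply/setP=> -[i u]; rewrite inE /=; apply/eqP/imsetP=> [->|].
      by exists i.
    by case=> j _ [-> ->].
  by rewrite card_imset ?card_ord // => i j [].
have -> : [set p : 'I_t * 'I_m | (p.1 == i) && (p.2 \in F e)] =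
          [set (i, u) | u in F e].
  apply/setP=> -[j u]; rewrite inE /=; apply/andP/imsetP=> [[/eqP-> uF]|].
    by exists u.
  by case=> v vF [-> ->].
by rewrite card_imset // => u v [].
Qed.

(** A line has one point per fibre, so it meets any block inside a fibre at most once; two lines are
    handled by [td_line_inj], two blocks of one fibre by [packF]. *)
Lemma td_block_packing : packing t td_block.
Proof.
split=> [|c d neq_cd]; first exact: card_td_block.
have [_ capF] := packF.
apply/card_le1_eqP=> -[i u] [j v]; rewrite !inE => /andP[].
case: c neq_cd => [[x y]|[k e]]; case: d => [[x' y']|[k' e']] neq_cd;
  rewrite !inE /=.
- move=> /eqP-> /eqP Ei /andP[/eqP-> /eqP Ej].
  case: (ltngtP i j) => [lt_ij|lt_ji|/val_inj-> //].
    have [ex ey] := td_line_inj lt_ij Ei Ej.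
    by rewrite ex ey eqxx in neq_cd.
  have [ex ey] := td_line_inj lt_ji Ej Ei.
  by rewrite ex ey eqxx in neq_cd.
- by move=> /eqP-> /andP[/eqP-> _] /andP[/eqP-> /andP[/eqP-> _]].
- by move=> /andP[/eqP-> _] /eqP-> /andP[/andP[/eqP-> _] /eqP->].
move=> /andP[/eqP-> uF] /andP[/eqP ek uF'].
move=> /andP[/andP[/eqP-> vF] /andP[_ vF']]; congr (_, _).
have neq_e : e != e'.
  by apply: contraNneq neq_cd => <-; rewrite ek.
by move/card_le1_eqP: (capF _ _ neq_e); apply; rewrite inE ?uF ?vF.
Qed.

End TransversalDesign.

(** * Recursive construction of nearly optimal packings *)

Lemma packable_step (t m B n : nat) :
    0 < m -> (forall d, 0 < d < t -> coprime d m) -> t * m <= n ->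
  packable t B m -> packable t (m * m + t * B) n.
Proof.
move=> m_gt0 co_m le_n [F packF].
apply: (packable_of_packing (td_block_packing m_gt0 co_m packF)).
  by rewrite card_sum !card_prod !card_ord.
by rewrite card_prod !card_ord.
Qed.

Lemma packable0 (t n : nat) : packable t 0 n.
Proof. by exists (fun=> set0); split=> -[]. Qed.

Lemma coprime_fact_succ (t d q : nat) : 0 < d < t -> coprime d (q * t`! + 1).
Proof.
move=> /andP[d_gt0 lt_dt].
have /dvdnP[s ->] : d %| t`! by rewrite dvdn_fact // d_gt0 ltnW.
by rewrite /coprime mulnA gcdnMDl gcdn1.
Qed.

(* Each recursion step divides the fraction of uncovered pairs by [t], up to a
   rounding error linear in [n]; [k] counts the steps. *)
Lemma packable_asymptotic (t : nat) : 1 < t -> forall k n, exists2 B,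
  packable t B n &
  t ^ k * n ^ 2 <= t ^ k * (t * t.-1 * B + k * (2 * t * t`!) * n) + n ^ 2.
Proof.
move=> t_gt1; set L := t`!; set D := 2 * t * L.
have L_gt0 : 0 < L by rewrite fact_gt0.
elim=> [|k IHk] n.
  by exists 0; [exact: packable0|lia].
have [lt_nt|le_tn] := ltnP n t.
  exists 0; first exact: packable0.
  suff : n ^ 2 <= t * t.-1 * 0 + k.+1 * D * n.
    by move=> H; rewrite (leq_trans _ (leq_addr _ _)) // leq_mul2l H orbT.
  rewrite muln0 add0n -mulnn leq_mul2r; apply/orP; right.
  rewrite (leq_trans (ltnW lt_nt)) // mulSn (leq_trans _ (leq_addr _ _)) //.
  by rewrite /D -mulnA mulnCA leq_pmulr // muln_gt0.
(* [m] is the largest number congruent to 1 modulo [t!] with [t * m <= n], so the remainder [r]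
   below is at most [t * t!]. *)
pose q := (n %/ t).-1 %/ L; pose m := q * L + 1.
have nt_gt0 : 0 < n %/ t by rewrite divn_gt0 // ltnW.
have m_gt0 : 0 < m by rewrite /m addn1.
have En := divn_eq n t; have Eq := divn_eq (n %/ t).-1 L.
have lt1 : n %% t < t by rewrite ltn_pmod // ltnW.
have lt2 : (n %/ t).-1 %% L < L by rewrite ltn_pmod.
have [r En' le_r] : exists2 r, n = t * m + r & r <= t * L.
  rewrite -/q in Eq.
  have Ent : n %/ t = m + (n %/ t).-1 %% L by rewrite /m; lia.
  exists (t * ((n %/ t).-1 %% L) + n %% t).
    by rewrite addnA -mulnDr -Ent mulnC.
  have : t * ((n %/ t).-1 %% L).+1 <= t * L by rewrite leq_mul2l lt2 orbT.
  by rewrite mulnS; lia.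
have [B packB leB] := IHk m.
exists (m * m + t * B).
  apply: packable_step packB => //; last by lia.
  by move=> d; apply: coprime_fact_succ.
rewrite expnS; move: leB; set T := t ^ k; set G := t * t.-1 * B => leB.
have -> : t * t.-1 * (m * m + t * B) = t * t.-1 * (m * m) + t * G.
  by rewrite /G; lia.
(* For [n = t * m + r], the excess [2 * t * m * r + r ^ 2] is at most [2 * t * L * n]; this dictates
   [D]. *)
have le1 : n ^ 2 <= (t * m) ^ 2 + D * n.
  rewrite En' sqrnD /D -mulnA.
  have : r * r <= r * (t * L) by rewrite leq_mul2l le_r orbT.
  have : t * m * r <= t * m * (t * L) by rewrite leq_mul2l le_r orbT.
  by rewrite -!mulnn; lia.
have le2 : t * T * (t * m) ^ 2 <=
    t * T * (t * t.-1 * (m * m) + t * G + k * D * n) + n ^ 2.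
  (* Pairs between different fibres, covered by the lines, plus pairs inside the [t] fibres, left to
     the induction hypothesis. *)
  have E : (t * m) ^ 2 = t * t.-1 * (m * m) + t * (m * m).
    by case: (t) t_gt1 => // t' _; rewrite -mulnn; lia.
  (* Scaled by [t ^ 2], the hypothesis leaves [(t * m) ^ 2 <= n ^ 2] over, now measured against
     [t ^ k.+1]: a gain of a factor [t]. *)
  have le3 : t * (t * (T * m ^ 2)) <=
             t * (t * (T * (G + k * D * m) + m ^ 2)).
    by rewrite !leq_mul2l leB !orbT.
  have le4 : t * T * (k * D * (t * m)) <= t * T * (k * D * n).
    by rewrite !leq_mul2l En' leq_addr !orbT.
  have le5 : (t * m) ^ 2 <= n ^ 2 by rewrite leq_exp2r // En' leq_addr.
  move: le3 le4 le5; rewrite {2}E -!mulnn; lia.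
have le6 : t * T * n ^ 2 <= t * T * ((t * m) ^ 2 + D * n).
  by rewrite leq_mul2l le1 orbT.
by apply: (leq_trans le6); rewrite mulSn; lia.
Qed.

(** * Counting bound on the number of blocks *)

Lemma sum_card_disjoint (I T : finType) (A : I -> {set T}) (U : {set T}) :
    (forall i, A i \subset U) ->
    (forall i j x, x \in A i -> x \in A j -> i = j) ->
  \sum_i #|A i| <= #|U|.
Proof.
move=> subU disjA.
have -> : \sum_i #|A i| = \sum_(x in U) \sum_i (x \in A i).
  rewrite exchange_big; apply: eq_bigr => i _ /=.
  rewrite -sum1_card big_mkcond [RHS]big_mkcond; apply: eq_bigr => x _.
  by case: (boolP (x \in A i)) => [/(subsetP (subU i)) ->|_] //; case: ifP.
rewrite -sum1_card; apply: leq_sum => x _.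
case: (pickP (fun i => x \in A i)) => [i xi|none]; last first.
  by rewrite big1 // => i _; rewrite none.
rewrite (bigD1 i) //= xi big1 // => j neq_ji.
by case: (boolP (x \in A j)) => // xj; rewrite (disjA _ _ _ xj xi) eqxx in neq_ji.
Qed.

Lemma card_offdiag (T : finType) (A : {set T}) :
  #|[set p in setX A A | p.1 != p.2]| = #|A| * #|A|.-1.
Proof.
have -> : #|A| * #|A|.-1 = \sum_(x in A) \sum_(y in A | x != y) 1.
  rewrite -sum_nat_const; apply: eq_bigr => x xA.
  rewrite (cardsD1 x) xA /= -sum1_card; apply: eq_bigl => y.
  by rewrite !inE andbC eq_sym.
rewrite pair_big_dep -sum1_card; apply: eq_bigl => -[x y].
by rewrite !inE /= andbA.
Qed.

(* An ordered pair of distinct points lies in at most one block. *)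
Lemma packing_card_le (t : nat) (B V : finType) (F : B -> {set V})
    (U : {set V}) :
  packing t F -> (forall i, F i \subset U) -> t * t.-1 * #|B| <= #|U| ^ 2.
Proof.
move=> [cardF capF] subU; rewrite -mulnn -cardsX.
have -> : t * t.-1 * #|B| =
    \sum_i #|[set p in setX (F i) (F i) | p.1 != p.2]|.
  rewrite mulnC -sum_nat_const; apply: eq_big => // i _.
  by rewrite card_offdiag cardF.
apply: sum_card_disjoint => [i|i j [x y]].
  apply/subsetP=> -[x y]; rewrite !inE /= => /andP[/andP[xF yF] _].
  by rewrite !(subsetP (subU i)).
rewrite !inE /= => /andP[/andP[xi yi] neq_xy] /andP[/andP[xj yj] _].
apply/eqP; apply: contraNT neq_xy => /capF /card_le1_eqP le1.
by apply/eqP; apply: le1; rewrite inE ?xi ?yi.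
Qed.

(** * Distances and tone colorings in complete multipartite graphs *)

Lemma gdist_eq (G : sgraph) (u v : G) (d : nat) :
    has_walk d u v -> (forall e, has_walk e u v -> d <= e) ->
  gdist u v = Some d.
Proof.
move=> wd min_d; rewrite /gdist; case: {-}_ / idP => [uv|].
  case: ex_minnP => e we min_e; congr Some; apply/eqP.
  by rewrite eqn_leq min_e // min_d.
case; case/existsP: wd => p /andP[pth /eqP <-].
by apply/connectP; exists p.
Qed.

Lemma gdist_complete_multipartite (b : nat) (a : 'I_b -> nat)
    (u v : complete_multipartite a) :
    1 < b -> (forall i, 0 < a i) -> u != v ->
  gdist u v = Some (if tag u == tag v then 2 else 1).
Proof.
move=> b_gt1 a_gt0 neq_uv; apply: gdist_eq.
  case: eqP => [eq_t|/eqP neq_t]; last first.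
    by apply/existsP; exists [tuple v]; rewrite /= /cmp_edge neq_t eqxx.
  (* A vertex of any other part is the midpoint of a walk of length 2. *)
  have [i neq_i] : exists i : 'I_b, i != tag u.
    pose i0 := Ordinal (ltnW b_gt1); pose i1 := Ordinal b_gt1.
    by case: (eqVneq i0 (tag u)) => [<-|]; [exists i1|exists i0].
  pose w : complete_multipartite a := Tagged (fun i => 'I_(a i)) (Ordinal (a_gt0 i)).
  apply/existsP; exists [tuple w; v].
  by rewrite /= /cmp_edge /= -eq_t eq_sym neq_i eqxx.
case=> [|[|e]] /existsP[p]; last by case: ifP.
  by rewrite tuple0 /= (negPf neq_uv).
case/tupleP: p => w p; rewrite tuple0 /= andbT /cmp_edge => /andP[neq_t /eqP ew].
by rewrite -ew (negPf neq_t).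
Qed.

Lemma tone_coloring_multipartiteP (t b : nat) (a : 'I_b -> nat) (C : finType)
    (f : {ffun complete_multipartite a -> {set C}}) :
    1 < b -> (forall i, 0 < a i) ->
  tone_coloring t f <->
  (forall i, packing t (fun j : 'I_(a i) => f (Tagged (fun i => 'I_(a i)) j))) /\
  (forall u v, tag u != tag v -> f u :&: f v = set0).
Proof.
move=> b_gt1 a_gt0; split.
  move=> /andP[/forallP cardf /forallP capf].
  have {}capf u v : u != v -> #|f u :&: f v| < if tag u == tag v then 2 else 1.
    move=> neq_uv; have /forallP/(_ v)/implyP/(_ neq_uv) := capf u.
    by rewrite gdist_complete_multipartite.
  split=> [i|u v neq_t].
    split=> [j|j k neq_jk]; first exact/eqP.
    have := capf (Tagged (fun i => 'I_(a i)) j) (Tagged (fun i => 'I_(a i)) k).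
    by rewrite eq_Tagged /= eqxx; apply.
  have neq_uv : u != v by apply: contraNneq neq_t => ->.
  have := capf _ _ neq_uv; rewrite (negPf neq_t) ltnS leqn0 cards_eq0.
  by move/eqP.
case=> packf disjf; apply/andP; split.
  by apply/forallP=> -[i j]; have [/(_ j)/eqP] := packf i.
apply/forallP=> u; apply/forallP=> v; apply/implyP=> neq_uv.
rewrite gdist_complete_multipartite //=; case: eqP => [|/eqP /disjf->]; last first.
  by rewrite cards0.
case: u v neq_uv => [i j] [i' k] neq_uv /= eq_i; subst i'.
have [_ capf] := packf i; rewrite ltnS; apply: capf.
by move: neq_uv; rewrite eq_Tagged.
Qed.

Lemma tone_colorable_of_packable (t b : nat) (a n : 'I_b -> nat) :
    1 < b -> (forall i, 0 < a i) -> (forall i, packable t (a i) (n i)) ->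
  tone_colorable t (complete_multipartite a) (\sum_i n i).
Proof.
move=> b_gt1 a_gt0 pack.
have /fin_all_exists [F packF] i : exists F : 'I_(a i) -> {set 'I_(n i)}, packing t F.
  exact: pack.
(* Keeping the palettes of the parts as summands of a disjoint union makes colors of different parts
   distinct. *)
pose T : finType := {i : 'I_b & 'I_(n i)}.
have [h injh] : exists h : T -> 'I_(\sum_i n i), injective h.
  by apply: inj_of_leq_card; rewrite card_ord tagnat.card.
pose g i (x : 'I_(n i)) := h (Tagged (fun i => 'I_(n i)) x).
have injg i : injective (@g i).
  by move=> x y /injh /eqP; rewrite eq_Tagged => /eqP.
apply/existsP; exists [ffun u => @g (tag u) @: F (tag u) (tagged u)].
apply/tone_coloring_multipartiteP => //; split=> [i|u v neq_t].
  have [cardF capF] := packF i; split=> [j|j k neq_jk]; rewrite !ffunE /=.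
    by rewrite card_imset; [exact: cardF|exact: injg].
  rewrite -imsetI; last by move=> x y _ _; apply: injg.
  by rewrite card_imset; [exact: capF|exact: injg].
rewrite !ffunE; apply/setP=> c; rewrite !inE; apply/negP=> /andP[].
case/imsetP=> x _ -> /imsetP[y _ /injh /(congr1 tag) /= eq_t].
by rewrite eq_t eqxx in neq_t.
Qed.

(** [c i] counts the colors used on part [i]: these color sets are disjoint, and the pair count
    applies to each. *)
Lemma tone_colorable_parts (t b : nat) (a : 'I_b -> nat) (n : nat) :
    1 < b -> (forall i, 0 < a i) ->
    tone_colorable t (complete_multipartite a) n ->
  exists2 c : 'I_b -> nat, \sum_i c i <= n &
    forall i, t * t.-1 * a i <= c i ^ 2.
Proof.
move=> b_gt1 a_gt0 /existsP[f] /tone_coloring_multipartiteP[] // packf disjf.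
pose F i (j : 'I_(a i)) := f (Tagged (fun i => 'I_(a i)) j).
pose U i := \bigcup_j @F i j.
exists (fun i => #|U i|) => [|i].
  rewrite -[X in _ <= X]card_ord -cardsT; apply: sum_card_disjoint => [i|i k x].
    exact: subsetT.
  case/bigcupP=> j _ xj /bigcupP[l _ xl]; apply/eqP.
  apply: contraT => neq_ik; have : x \in @F i j :&: @F k l by rewrite inE xj.
  by rewrite disjf // inE.
rewrite -[X in _ * X]card_ord; apply: (packing_card_le (packf i)) => j.
exact: (bigcup_sup j).
Qed.

Lemma packable_le (t a a' n : nat) :
  a <= a' -> packable t a' n -> packable t a n.
Proof.
by move=> le_a [F packF]; apply: (packable_of_packing packF); rewrite card_ord.
Qed.

Local Open Scope ring_scope.

(** * Passage to square roots *)

Lemma natr_mul_pred (R : pzRingType) (t : nat) :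
  (0 < t)%N -> t%:R * (t%:R - 1) = (t * t.-1)%:R :> R.
Proof. by move=> t_gt0; rewrite natrM -subn1 natrB. Qed.

(** Taking [n] at least [(1 + delta / 2) * s] gains a factor [1 + delta] in [n ^ 2], which pays for
    the uncovered pairs. *)
Lemma packable_sqrt (R : realType) (t : nat) (delta : R) :
  (1 < t)%N -> 0 < delta -> exists a0 : nat, forall a, (a0 < a)%N ->
  exists2 n, packable t a n &
    n%:R <= (1 + delta) * Num.sqrt (t%:R * (t%:R - 1) * a%:R).
Proof.
move=> t_gt1 delta_gt0.
have d1_gt0 : 0 < 1 + delta by lra.
(* Two errors, [n ^ 2 / t ^ k] and [k * D * n], get [eps * n ^ 2] each; [eps] solves
   [(1 - 2 * eps) * (1 + delta) = 1]. *)
pose eps := delta / (1 + delta) / 2.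
have eps_gt0 : 0 < eps by rewrite !divr_gt0.
have eps_eq : (1 - 2 * eps) * (1 + delta) = 1 by rewrite /eps; field; lra.
pose k := (Num.truncn eps^-1).+1; pose D := (2 * t * t`!)%N.
have T_large : 1 <= eps * (t ^ k)%:R.
  rewrite mulrC -ler_pdivrMr // div1r ltW //.
  by apply: (lt_le_trans (truncnS_gt _)); rewrite ler_nat ltnW // ltn_expl.
(* For [s >= M], the first summand makes the linear error at most [eps * n ^ 2], and the second
   gives [delta * s >= 2], so that rounding [n] down costs at most [delta / 2 * s]. *)
pose M := (k * D)%:R / eps + 2 / delta.
have kD_ge0 : 0 <= (k * D)%:R / eps by rewrite divr_ge0 ?ler0n // ltW.
have d2_gt0 : 0 < 2 / delta by rewrite divr_gt0.
exists (Num.truncn (M ^+ 2)) => a lt_a.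
set s := Num.sqrt _.
have s2 : s ^+ 2 = (t * t.-1 * a)%:R.
  by rewrite sqr_sqrtr natr_mul_pred 1?ltnW // -natrM // ler0n.
have s_ge0 : 0 <= s by apply: sqrtr_ge0.
have le_Ms : M <= s.
  rewrite -(@ler_pXn2r _ 2) ?nnegrE //; last by rewrite /M; lra.
  rewrite s2; apply: (@le_trans _ _ a%:R).
    by apply: ltW; apply: (lt_le_trans (truncnS_gt _)); rewrite ler_nat.
  by rewrite ler_nat leq_pmull // muln_gt0 (ltnW t_gt1) /= -subn1 subn_gt0.
have ds : 2 <= delta * s.
  by rewrite mulrC -ler_pdivrMr //; apply: le_trans le_Ms; rewrite /M; lra.
pose n := Num.truncn ((1 + delta) * s).
have /andP[n_le n_gt] : n%:R <= (1 + delta) * s < n.+1%:R.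
  by apply: truncn_itv; rewrite mulr_ge0 // ltW.
have n_ge : (1 + delta / 2) * s <= n%:R by move: n_gt; rewrite -natr1; lra.
have sn : s <= n%:R by nra.
exists n => //; have [B packB leB] := packable_asymptotic t_gt1 k n.
apply: packable_le packB.
have T_gt0 : 0 < (t ^ k)%:R :> R by rewrite ltr0n expn_gt0 ltnW.
have kDn : (k * D)%:R * n%:R <= eps * n%:R ^+ 2 :> R.
  rewrite expr2 mulrA ler_wpM2r ?ler0n // mulrC -ler_pdivrMr //.
  by apply: le_trans sn; apply: le_trans le_Ms; rewrite /M; lra.
have le1 : n%:R ^+ 2 <= (t * t.-1 * B)%:R + (k * D)%:R * n%:R + eps * n%:R ^+ 2 :> R.
  rewrite -(ler_pM2l T_gt0) mulrDr.
  move: leB; rewrite -(ler_nat R) natrD !(natrM _ (t ^ k)) natrD.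
  rewrite (natrM _ _ n) -/D (natrX _ n) => leB.
  apply: (le_trans leB); rewrite lerD2l mulrA [_ * eps]mulrC.
  by rewrite ler_peMl // exprn_ge0 // ler0n.
have le2 : n%:R ^+ 2 <= (1 + delta) * (t * t.-1 * B)%:R :> R.
  have : (1 - 2 * eps) * n%:R ^+ 2 <= (t * t.-1 * B)%:R :> R by lra.
  by rewrite -(ler_pM2l d1_gt0) mulrA [_ * (1 - _)]mulrC eps_eq mul1r.
have le3 : (1 + delta) * s ^+ 2 <= n%:R ^+ 2.
  apply: (@le_trans _ _ (((1 + delta / 2) * s) ^+ 2)); last first.
    by rewrite ler_pXn2r ?nnegrE ?ler0n // mulr_ge0 //; lra.
  by rewrite exprMn ler_wpM2r ?exprn_ge0 //; nra.
have := le_trans le3 le2; rewrite ler_pM2l // s2 ler_nat leq_pmul2l //.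
by rewrite muln_gt0 (ltnW t_gt1) /= -subn1 subn_gt0.
Qed.

Theorem theorem1p10 (R : realType) (t b : nat) (ht : (2 <= t)%N)
    (hb : (2 <= b)%N) (delta : R) (hdelta : 0 < delta) :
  exists a0 : nat, forall a : 'I_b -> nat,
    (forall i, (0 < a i)%N) ->
    (forall i, (a0 < a i)%N) ->
    \sum_(i < b) Num.sqrt (t%:R * (t%:R - 1) * (a i)%:R) <=
      (tone_chromatic_number t (complete_multipartite a))%:R :> R /\
    (tone_chromatic_number t (complete_multipartite a))%:R <=
      (1 + delta) * \sum_(i < b) Num.sqrt (t%:R * (t%:R - 1) * (a i)%:R) :> R.
Proof.
(* The threshold for a single part serves all parts at once, so both bounds can be summed
   termwise. *)
have [a0 pack] := packable_sqrt ht hdelta.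
exists a0 => a a_gt0 a_large; rewrite /tone_chromatic_number.
case: ex_minnP => N colN minN; split.
  have [c sum_c le_c] := tone_colorable_parts hb a_gt0 colN.
  apply: (@le_trans _ _ (\sum_i c i)%:R); last by rewrite ler_nat.
  rewrite natr_sum; apply: ler_sum => i _.
  rewrite -[leRHS]ger0_norm ?ler0n // -sqrtr_sqr ler_wsqrtr //.
  by rewrite natr_mul_pred 1?ltnW // -natrM -natrX ler_nat.
have /fin_all_exists2 [n packn le_n] i := pack (a i) (a_large i).
apply: (@le_trans _ _ (\sum_i n i)%:R).
  by rewrite ler_nat minN // tone_colorable_of_packable.
by rewrite natr_sum mulr_sumr; apply: ler_sum => i _.
Qed.
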